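(* Let $M$ be any pointed metric space containing $[0,1]$ isometrically, i.e. such that there is a distance-preserving map from $[0,1]$ (with its usual metric) into $M$. Then there is a linear subspace of $\mathrm{Lip}_0(M)$ which is contained in $\mathrm{SNA}(M)$ and is isometrically isomorphic to $c_0$.
   Context: All vector spaces are real. A pointed metric space $(M,\rho)$ is a metric space with at least 2 points and a distinguished point $0\in M$ (which is not required to lie in the isometric copy of $[0,1]$). $\mathrm{Lip}_0(M)$ is the Banach space of all Lipschitz functions $f:M\to\mathbb{R}$ with $f(0)=0$, normed by the Lipschitz constant $\|f\|=\sup\{|f(x)-f(y)|/\rho(x,y): x,y\in M,\ x\neq y\}$. A function $f\in\mathrm{Lip}_0(M)$ attains its norm strongly if there are $x\neq y$ in $M$ with $\|f\|=|f(x)-f(y)|/\rho(x,y)$; $\mathrm{SNA}(M)\subset\mathrm{Lip}_0(M)$ is the set of all such $f$. $c_0$ is the Banach space of real sequences converging to $0$ with the supremum norm. *)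

(* Defs.v *)
From HB Require Import structures.
From mathcomp Require Import all_boot all_order all_algebra.
From mathcomp Require Import all_classical all_reals all_analysis.

Set Implicit Arguments.
Unset Strict Implicit.
Unset Printing Implicit Defensive.

Import Order.TTheory GRing.Theory Num.Theory.
Import numFieldNormedType.Exports.

Local Open Scope classical_set_scope.
Local Open Scope ring_scope.

Section Lip0.
Context {R : realType} {M : metricType R}.
Implicit Types (f g : M -> R) (o : M).

(* The library's [k.-lipschitz] requires a normed module as domain. *)
Definition is_lipschitz f : Prop :=
  exists L : R, forall x y, `|f x - f y| <= L * mdist x y.

Definition lip0_pred o : {pred M -> R} :=
  mem [set f | is_lipschitz f /\ f o = 0].

Lemma lip0_predP o f : reflect (is_lipschitz f /\ f o = 0) (f \in lip0_pred o).
Proof. by apply: (iffP idP) => [/set_mem|/mem_set]. Qed.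

Lemma lip0_submod_closed o : submod_closed (lip0_pred o).
Proof.
split=> [|a f g /lip0_predP[[K fK] f0] /lip0_predP[[L gL] g0]].
  apply/lip0_predP; split=> //; exists 0 => x y.
  by rewrite subrr normr0 mul0r.
apply/lip0_predP; split; last first.
  by rewrite /= fctE /= fctE f0 g0 scaler0 addr0.
exists (`|a| * K + L) => x y.
have -> : (a *: f + g) x - (a *: f + g) y = a * (f x - f y) + (g x - g y).
  by rewrite mulrBr addrACA -opprD.
by rewrite mulrDl (le_trans (ler_normD _ _))// lerD// normrM -mulrA ler_wpM2l.
Qed.

HB.instance Definition _ o :=
  GRing.isSubmodClosed.Build R (M -> R) (lip0_pred o) (lip0_submod_closed o).

Record Lip0 o := MkLip0 { lip0_fun :> M -> R; _ : lip0_fun \in lip0_pred o }.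

HB.instance Definition _ o := [isSub for @lip0_fun o].
HB.instance Definition _ o := [Choice of Lip0 o by <:].
HB.instance Definition _ o := [SubChoice_isSubLmodule of Lip0 o by <:].

Definition slopes f : set R :=
  [set r | exists x y, x != y /\ r = `|f x - f y| / mdist x y].

(* [sup] is 0 on unbounded sets, so this is the Lipschitz constant only for
   Lipschitz [f]; see [lip_constP] and [lip_const_le]. *)
Definition lip_const f : R := sup (slopes f).

Section theory.
Variable o : M.
Implicit Types F G : Lip0 o.

Lemma lip0D F G x : (F + G) x = F x + G x. Proof. by []. Qed.
Lemma lip0Z a F x : (a *: F) x = a * F x. Proof. by []. Qed.

Lemma slopes_has_ubound F : has_ubound (slopes F).
Proof.
have /lip0_predP[[L FL] _] := valP F.
exists L => _ [x [y [xy ->]]].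
by rewrite ler_pdivrMr ?mdist_gt0//; exact: FL.
Qed.

Lemma lip_const_ge0 F : 0 <= lip_const F.
Proof.
have [[r]|] := pselect (slopes F !=set0); last first.
  by move=> /set0P/negP/negPn/eqP S0; rewrite /lip_const S0 sup0.
move=> Sr; apply: le_trans (ub_le_sup (slopes_has_ubound F) Sr).
by case: Sr => x [y [_ ->]]; rewrite divr_ge0// mdist_ge0.
Qed.

Lemma lip_constP F x y : `|F x - F y| <= lip_const F * mdist x y.
Proof.
have [->|xy] := eqVneq x y; first by rewrite subrr normr0 mdistxx mulr0.
rewrite -ler_pdivrMr ?mdist_gt0//.
by apply: ub_le_sup (slopes_has_ubound F) _ _; exists x, y.
Qed.

Lemma lip_const_le F (L : R) : 0 <= L ->
  (forall x y, `|F x - F y| <= L * mdist x y) -> lip_const F <= L.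
Proof.
move=> L0 FL; have [S0|] := pselect (slopes F !=set0); last first.
  by move=> /set0P/negP/negPn/eqP S0; rewrite /lip_const S0 sup0.
apply: ge_sup => // _ [x [y [xy ->]]].
by rewrite ler_pdivrMr ?mdist_gt0//; exact: FL.
Qed.

Lemma lip_constD F G : lip_const (F + G) <= lip_const F + lip_const G.
Proof.
apply: lip_const_le => [|x y]; first by rewrite addr_ge0// lip_const_ge0.
rewrite !lip0D opprD addrACA mulrDl (le_trans (ler_normD _ _))//.
by rewrite lerD// lip_constP.
Qed.

Lemma lip_constZ_le a F : lip_const (a *: F) <= `|a| * lip_const F.
Proof.
apply: lip_const_le => [|x y]; first by rewrite mulr_ge0// lip_const_ge0.
by rewrite !lip0Z -mulrBr normrM -mulrA ler_wpM2l// lip_constP.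
Qed.

Lemma lip_constZ a F : lip_const (a *: F) = `|a| * lip_const F.
Proof.
apply/eqP; rewrite eq_le lip_constZ_le andTb.
have [->|a0] := eqVneq a 0; first by rewrite normr0 mul0r lip_const_ge0.
rewrite -ler_pdivlMl ?normr_gt0// -normfV.
by rewrite -[X in lip_const (lip0_fun X) <= _](scalerK a0) lip_constZ_le.
Qed.

Lemma lip_const_eq0 F : lip_const F = 0 -> F = 0.
Proof.
move=> F0; apply/val_inj/funext => x /=.
have := lip_constP F x o; rewrite F0 mul0r normr_le0 subr_eq0 => /eqP ->.
by have /lip0_predP[] := valP F.
Qed.

End theory.

HB.instance Definition _ o := @Lmodule_isNormed.Build R (Lip0 o)
  (fun F => lip_const F) (@lip_constD o) (@lip_constZ o) (@lip_const_eq0 o).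

Lemma lip0_normE o (F : Lip0 o) : `|F| = lip_const F. Proof. by []. Qed.

Definition SNA o : set (Lip0 o) :=
  [set F : Lip0 o | exists x y, x != y /\ `|F| = `|F x - F y| / mdist x y].

End Lip0.

Arguments Lip0 {R M} o.
Arguments SNA {R M} o.

Section c0.
Context {R : realType}.

Definition c0_pred : {pred nat -> R} := mem [set u : nat -> R | u @ \oo --> (0 : R)].

Lemma c0_predP (u : nat -> R) : reflect (u @ \oo --> (0 : R)) (u \in c0_pred).
Proof. by apply: (iffP idP) => [/set_mem|/mem_set]. Qed.

Lemma c0_submod_closed : submod_closed c0_pred.
Proof.
split=> [|a u v /c0_predP u0 /c0_predP v0]; apply/c0_predP; first exact: cvg_cst.
rewrite -[X in _ --> X]addr0 -{1}(mulr0 a).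
by apply: cvgD => //; apply: cvgM => //; exact: cvg_cst.
Qed.

HB.instance Definition _ :=
  GRing.isSubmodClosed.Build R (nat -> R) c0_pred c0_submod_closed.

Record c0 := MkC0 { c0_seq :> nat -> R; _ : c0_seq \in c0_pred }.

HB.instance Definition _ := [isSub for c0_seq].
HB.instance Definition _ := [Choice of c0 by <:].
HB.instance Definition _ := [SubChoice_isSubLmodule of c0 by <:].

(* Only meaningful for bounded [u]: [sup] is 0 on unbounded sets. *)
Definition sup_norm (u : nat -> R) : R := sup (range (fun n => `|u n|)).

Implicit Types u v : c0.

Lemma c0D u v n : (u + v) n = u n + v n. Proof. by []. Qed.
Lemma c0Z a u n : (a *: u) n = a * u n. Proof. by []. Qed.

Lemma c0_has_ubound u : has_ubound (range (fun n => `|u n|)).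
Proof.
have /c0_predP u0 := valP u.
have /cvg_seq_bounded[K [_ /(_ (K + 1))]] : cvgn (u : nat -> R) by apply/cvg_ex; exists 0.
rewrite ltrDl ltr01 => /(_ isT) uK.
by exists (K + 1) => _ [n _ <-]; exact: uK.
Qed.

Lemma sup_normP u n : `|u n| <= sup_norm u.
Proof. by apply: ub_le_sup (c0_has_ubound u) _ _; exists n. Qed.

Lemma sup_norm_ge0 u : 0 <= sup_norm u.
Proof. exact: le_trans (sup_normP u 0). Qed.

Lemma sup_norm_le u (K : R) : (forall n, `|u n| <= K) -> sup_norm u <= K.
Proof.
by move=> uK; apply: ge_sup => [|_ [n _ <-]//]; exists `|u 0%N|; exists 0%N.
Qed.

Lemma sup_normD u v : sup_norm (u + v) <= sup_norm u + sup_norm v.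
Proof.
apply: sup_norm_le => n; rewrite c0D (le_trans (ler_normD _ _))//.
by rewrite lerD// sup_normP.
Qed.

Lemma sup_normZ_le a u : sup_norm (a *: u) <= `|a| * sup_norm u.
Proof.
by apply: sup_norm_le => n; rewrite c0Z normrM ler_wpM2l// sup_normP.
Qed.

Lemma sup_normZ a u : sup_norm (a *: u) = `|a| * sup_norm u.
Proof.
apply/eqP; rewrite eq_le sup_normZ_le andTb.
have [->|a0] := eqVneq a 0; first by rewrite normr0 mul0r sup_norm_ge0.
rewrite -ler_pdivlMl ?normr_gt0// -normfV.
by rewrite -[X in sup_norm (c0_seq X) <= _](scalerK a0) sup_normZ_le.
Qed.

Lemma sup_norm_eq0 u : sup_norm u = 0 -> u = 0.
Proof.
move=> u0; apply/val_inj/funext => n /=.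
by have := sup_normP u n; rewrite u0 normr_le0 => /eqP.
Qed.

HB.instance Definition _ := @Lmodule_isNormed.Build R c0
  (fun u => sup_norm u) sup_normD sup_normZ sup_norm_eq0.

Lemma c0_normE u : `|u| = sup_norm u. Proof. by []. Qed.

End c0.

Arguments c0 R : clear implicits.

(* Main.v *)
Require Import Defs.
From HB Require Import structures.
From mathcomp Require Import all_boot all_order all_algebra.
From mathcomp Require Import all_classical all_reals all_analysis.
From mathcomp Require Import lra.
Import Order.TTheory GRing.Theory Num.Theory.
Import numFieldNormedType.Exports.
Local Open Scope classical_set_scope.
Local Open Scope ring_scope.

(** Choose points [c n] of [M] and radii [h n > 0] such that the balls of centre
[c n] and radius [h n] are pairwise nonoverlapping, in the sense that
[h n + h m] is at most the distance from [c n] to [c m].  The cones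
[max 0 (h n - d(x, c n))] are 1-Lipschitz and have disjoint supports, so one can
form the combination of the cones with any bounded sequence [u] of
coefficients.  It is Lipschitz with constant [sup |u n|]: inside one ball this
is clear, and if [x] and [y] lie in two different balls then the triangle
inequality between the centres gives
[(h n - d(x, c n)) + (h m - d(y, c m)) <= d(x, y)] (lemma [coneD_le]).  So no
extension theorem is involved: the cones are defined on all of [M] by the
distance, and the argument for the line works in any metric space.

If the sphere of centre [c n] and radius [h n] contains a point [p n], the slope
between [c n] and [p n] is exactly [|u n|].  A null sequence attains its supremum
norm at some index [n] (lemma [c0_norm_attained]), so the slope between [c n] and
[p n] is the norm of the combination.  Hence [u |-> combination] is a linear
isometry of [c_0] into the strongly norm-attaining functions; subtracting the
value at the base point changes no slope.

The isometric copy of [0,1] serves only to supply the points: the centres are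
the images of [2^-n], the radii are [2^-(n+2)]. *)

(** If [u k] is nonzero, the entries beyond some [N] are smaller than [|u k|], so
the supremum is a maximum over the finitely many indices below [N]. *)
Lemma c0_norm_attained (R : realType) (u : c0 R) : exists n, `|u| = `|u n|.
Proof.
have [[k uk]|u0] := pselect (exists k, u k != 0); last first.
  exists 0%N; apply/eqP; rewrite eq_le c0_normE sup_normP andbT.
  apply: sup_norm_le => n; suff -> : u n = 0 by rewrite normr0.
  by apply/eqP/negPn/negP => un; apply: u0; exists n.
have /c0_predP/cvgr0Pnorm_lt/(_ `|u k|) := valP u.
rewrite normr_gt0 => /(_ uk)[N _ uN].
have kN : (k < N)%N by rewrite ltnNge; apply/negP => /uN /=; rewrite ltxx.
pose n := [arg max_(n > Ordinal kN) `|u (n : 'I_N)|]%O.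
have n_max (m : 'I_N) : `|u m| <= `|u n|.
  by rewrite /n; case: Order.TotalTheory.arg_maxP => // j _; apply.
exists n; apply/eqP; rewrite eq_le c0_normE sup_normP andbT.
apply: sup_norm_le => m; have [Nm|mN] := leqP N m.
  exact: le_trans (ltW (uN _ Nm)) (n_max (Ordinal kN)).
exact: n_max (Ordinal mN).
Qed.

(** * Combinations of cones over nonoverlapping balls *)

Section Cones.
Context {R : realType} {M : metricType R} (c : nat -> M) (h : nat -> R).

Definition cone n (x : M) : R := Num.max 0 (h n - mdist x (c n)).

Definition nonoverlapping := forall n m, n != m -> h n + h m <= mdist (c n) (c m).

Lemma cone_ge0 n x : 0 <= cone n x.
Proof. by rewrite /cone le_max lexx. Qed.

Lemma cone_le n x y : cone n x <= cone n y + mdist x y.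
Proof.
have := metric_triangle y x (c n); have := mdist_ge0 x y.
rewrite (metric_sym x y) => d0 tri; rewrite /cone.
by case: (ltrP 0 (h n - mdist x _)); case: (ltrP 0 (h n - mdist y _)); lra.
Qed.

Lemma cone_dist n x y : `|cone n x - cone n y| <= mdist x y.
Proof.
have := cone_le n x y; have := cone_le n y x.
by rewrite ler_norml (metric_sym y x); lra.
Qed.

Context (hc : nonoverlapping).

Lemma cone_disjoint n m x : n != m -> 0 < cone n x -> cone m x = 0.
Proof.
move=> nm; have := hc n m nm.
have := metric_triangle (c n) x (c m); rewrite (metric_sym (c n) x) /cone.
by case: (ltrP 0 (h n - _)); case: (ltrP 0 (h m - _)); lra.
Qed.

(** The hypotheses on the two vanishing cones cover the case where one of the
two points lies in neither ball, so that the distance between the centres says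
nothing. *)
Lemma coneD_le n m x y : n != m -> cone n y = 0 -> cone m x = 0 ->
  cone n x + cone m y <= mdist x y.
Proof.
move=> nm ny mx; have := cone_le n x y; have := cone_le m y x.
rewrite ny mx (metric_sym y x); have := hc n m nm.
have := metric_triangle (c n) x (c m); have := metric_triangle x y (c m).
rewrite (metric_sym (c n) x) /cone.
by case: (ltrP 0 (h n - _)); case: (ltrP 0 (h m - _)); lra.
Qed.

(** The index of the ball in whose interior [x] lies, and [0] if there is none:
then all cones vanish at [x], and the index does not matter. *)
Definition owner (x : M) : nat := xget 0%N [set n | 0 < cone n x].

Lemma cone_owner n x : n != owner x -> cone n x = 0.
Proof.
move=> nx; have [cx|] := ltrP 0 (cone n x).
  have ox : 0 < cone (owner x) x by exact: (@xgetI _ 0%N [set k | 0 < cone k x] n).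
  by apply: (cone_disjoint (owner x)) => //; rewrite eq_sym.
by move=> n0; apply/eqP; rewrite eq_le n0 cone_ge0.
Qed.

(** The pointwise sum of [u n * cone n x] over all [n], of which at most one term
is nonzero.  Writing that term alone makes linearity in [u] immediate. *)
Definition cone_comb (u : nat -> R) (x : M) : R := u (owner x) * cone (owner x) x.

Lemma cone_combE u n x : (forall m, m != n -> cone m x = 0) ->
  cone_comb u x = u n * cone n x.
Proof.
move=> xn; rewrite /cone_comb; have [->//|nx] := eqVneq (owner x) n.
by rewrite xn// (cone_owner n) 1?eq_sym// !mulr0.
Qed.

Lemma cone_comb_lip (u : nat -> R) K x y : (forall n, `|u n| <= K) ->
  `|cone_comb u x - cone_comb u y| <= K * mdist x y.
Proof.
move=> uK; have K0 : 0 <= K by exact: le_trans (uK 0%N).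
rewrite /cone_comb; have [->|xy] := eqVneq (owner x) (owner y).
  by rewrite -mulrBr normrM ler_pM// cone_dist.
rewrite (le_trans (ler_normB _ _))// !normrM !(ger0_norm (cone_ge0 _ _)).
apply: (@le_trans _ _ (K * (cone (owner x) x + cone (owner y) y))).
  by rewrite mulrDr lerD// ler_wpM2r ?cone_ge0.
by rewrite ler_wpM2l// coneD_le// cone_owner// eq_sym.
Qed.

(** The cone over the ball of index [n] drops from [h n] to [0] along the
distance [h n], and all other cones vanish at both ends. *)
Lemma cone_comb_slope (u : nat -> R) n p : 0 < h n -> mdist (c n) p = h n ->
  `|cone_comb u (c n) - cone_comb u p| / mdist (c n) p = `|u n|.
Proof.
move=> hn cp.
have cone_c : cone n (c n) = h n by rewrite /cone mdistxx subr0 max_r// ltW.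
have cone_p : cone n p = 0 by rewrite /cone (metric_sym p) cp subrr maxxx.
rewrite (cone_combE u n (c n)); last first.
  by move=> m mn; apply: (cone_disjoint n); rewrite ?cone_c// eq_sym.
rewrite (cone_combE u n p); last first.
  move=> m mn; apply/eqP; rewrite eq_le cone_ge0 andbT /cone ge_max lexx /=.
  have := hc m n mn; have := metric_triangle (c m) p (c n).
  by rewrite (metric_sym (c m) p) (metric_sym p (c n)) cp; lra.
by rewrite cone_c cone_p mulr0 subr0 cp normrM (gtr0_norm hn) mulfK// gt_eqF.
Qed.

Context (o : M).

Let cone_fun (u : c0 R) (x : M) : R := cone_comb u x - cone_comb u o.

Lemma cone_fun_dist (u : c0 R) x y :
  cone_fun u x - cone_fun u y = cone_comb u x - cone_comb u y.
Proof. by rewrite /cone_fun opprB addrA subrK. Qed.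

Lemma cone_fun_lip0 (u : c0 R) : cone_fun u \in lip0_pred o.
Proof.
apply/lip0_predP; split; last by rewrite /cone_fun subrr.
by exists (sup_norm u) => x y; rewrite cone_fun_dist; exact/cone_comb_lip/sup_normP.
Qed.

Definition cone_Lip0 (u : c0 R) : Lip0 o := MkLip0 (cone_fun_lip0 u).

Lemma cone_Lip0_linear : linear cone_Lip0.
Proof.
move=> a u v; apply/val_inj/funext => x.
have comb y : cone_comb (a *: u + v) y = a * cone_comb u y + cone_comb v y.
  by rewrite /cone_comb c0D c0Z mulrDl mulrA.
change (cone_fun (a *: u + v) x = a * cone_fun u x + cone_fun v x).
by rewrite /cone_fun !comb mulrBr opprD addrACA.
Qed.

Lemma cone_Lip0_attained (p : nat -> M) (u : c0 R) :
    (forall n, 0 < h n) -> (forall n, mdist (c n) (p n) = h n) ->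
  SNA o (cone_Lip0 u) /\ `|cone_Lip0 u| = `|u|.
Proof.
move=> h0 cp; have [n un] := c0_norm_attained R u.
have cpn : c n != p n by rewrite -mdist_gt0 cp.
have slope : `|cone_Lip0 u (c n) - cone_Lip0 u (p n)| / mdist (c n) (p n) = `|u|.
  by rewrite un -(cone_comb_slope u n (p n))//= cone_fun_dist.
suff norm_u : `|cone_Lip0 u| = `|u|.
  by split=> //; exists (c n), (p n); rewrite norm_u slope.
apply/eqP; rewrite eq_le; apply/andP; split.
  apply: lip_const_le => // x y; rewrite /= cone_fun_dist.
  exact/cone_comb_lip/sup_normP.
by rewrite -slope ler_pdivrMr ?mdist_gt0// lip_constP.
Qed.

End Cones.

(** * Balls centred on an isometric copy of the unit interval *)

(** For [n < m] the right-hand side is at least [2^-(n+1) = 2^-(n+2) + 2^-(n+2)]. *)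
Lemma dyadic_gap (R : realType) (n m : nat) : n != m ->
  2^-1 ^+ n.+2 + 2^-1 ^+ m.+2 <= `|2^-1 ^+ n - 2^-1 ^+ m| :> R.
Proof.
wlog nm : n m / (n < m)%N => [th nm|_].
  case: (ltngtP n m) nm => // nm _; first by apply: th; rewrite ?ltn_eqF.
  by rewrite addrC distrC; apply: th; rewrite ?ltn_eqF.
have : 2^-1 ^+ m <= 2^-1 ^+ n.+1 :> R.
  by apply: ler_wiXn2l => //; lra.
have : 0 <= 2^-1 ^+ n :> R by apply: exprn_ge0; lra.
rewrite !exprS => n0 mn; rewrite ger0_norm; lra.
Qed.

Theorem proposition3p9 (R : realType) (M : metricType R) (o : M)
  (M_ge2 : exists x y : M, x != y)
  (M_itv01 : exists i : R -> M,
     {in `[0, 1] &, forall s t : R, mdist (i s) (i t) = `|s - t|}) :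
  exists V : set (Lip0 o),
    [/\ submod_closed (mem V), V `<=` SNA o &
        exists phi : {linear c0 R -> Lip0 o},
          (forall u, `|phi u| = `|u|) /\ range phi = V].
Proof.
have [i i_isom] := M_itv01.
pose a n : R := 2^-1 ^+ n.
pose c n := i (a n); pose h n := a n.+2; pose p n := i (a n - h n).
have a_gt0 n : 0 < a n by apply: exprn_gt0; lra.
have a_le1 n : a n <= 1 by apply: exprn_ile1; lra.
have h_le n : h n <= a n by have := a_gt0 n; rewrite /h /a !exprS; lra.
have a01 n : a n \in `[0, 1] by rewrite in_itv /= a_le1 ltW.
have hc : nonoverlapping c h.
  by move=> n m nm; rewrite /c i_isom//; exact: dyadic_gap.
have cp n : mdist (c n) (p n) = h n.
  rewrite /c /p i_isom//.
    by rewrite opprB addrC subrK gtr0_norm// a_gt0.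
  have := h_le n; have := a_gt0 n.+2; have := a_le1 n.
  by rewrite in_itv /= -/(h n) => *; apply/andP; split; lra.
have att u := cone_Lip0_attained c h hc o p u (fun n => a_gt0 n.+2) cp.
pose phi : {linear c0 R -> Lip0 o} := HB.pack (cone_Lip0 c h hc o)
  (GRing.isLinear.Build _ _ _ _ _ (cone_Lip0_linear c h hc o)).
exists (range phi); split.
- split=> [|b _ _ /set_mem[u _ <-] /set_mem[v _ <-]]; apply/mem_set.
    by exists 0 => //; rewrite raddf0.
  by exists (b *: u + v) => //; rewrite linearP.
- by move=> _ [u _ <-]; exact: (att u).1.
- by exists phi; split=> // u; exact: (att u).2.
Qed.
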